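(* Let $K_{\mathrm{Lap}}(s,t)=\exp(-|s-t|)$ on $\mathbb{R}$. Then the functional $\mu\mapsto H_{K_{\mathrm{Lap}}}(\mu)$ is concave on the class $$\mathcal{P}_1(\mathbb{R}):=\Bigl\{\mu:\ \mu\text{ a Borel probability measure on }\mathbb{R},\ \int_{\mathbb{R}}|s|\,d\mu(s)<\infty\Bigr\}.$$ Moreover, $H_{K_{\mathrm{Lap}}}(\mu)<\infty$ for every $\mu\in\mathcal{P}_1(\mathbb{R})$.
   Context: For a Borel probability measure $\mu$ on $\mathbb{R}$ and a measurable symmetric $K:\mathbb{R}\times\mathbb{R}\to[0,1]$ with $K(s,s)=1$, the $K$-entropy is $H_K(\mu):=\int_{\mathbb{R}}-\log\Bigl(\int_{\mathbb{R}}K(s,t)\,d\mu(t)\Bigr)\,d\mu(s)\in[0,\infty]$, with $-\log 0:=+\infty$. *)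

(* Defs.v *)
From HB Require Import structures.
From mathcomp Require Import all_boot all_order all_algebra.
From mathcomp Require Import all_classical all_reals all_analysis.
From mathcomp Require Import measurable_realfun.

Set Implicit Arguments.
Unset Strict Implicit.
Unset Printing Implicit Defensive.

Import Order.TTheory GRing.Theory Num.Theory.
Import numFieldNormedType.Exports.

Local Open Scope classical_set_scope.
Local Open Scope ring_scope.
Local Open Scope ereal_scope.

(* [measurableTypeR R] is the real line with its Borel sigma-algebra. *)
Notation borel_probability R := (probability (measurableTypeR R) R).

Section mixture.
Context d (T : measurableType d) (R : realType).
Variables (t : {i01 R}) (mu nu : probability T R).

Definition mixture : set T -> \bar R :=
  measure_add (mscale (t%:num%:nng)%R mu) (mscale ((1 - t%:num)%:nng)%R nu).

HB.instance Definition _ := Measure.on mixture.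

Lemma mixtureE A : mixture A = t%:num%:E * mu A + (1 - t%:num)%R%:E * nu A.
Proof. by rewrite /mixture measure_addE. Qed.

Let mixture_setT : mixture setT = 1.
Proof.
by rewrite mixtureE !probability_setT !mule1 -EFinD addrC subrK.
Qed.

HB.instance Definition _ :=
  Measure_isProbability.Build _ _ _ mixture mixture_setT.

End mixture.

Definition convex_class d (T : measurableType d) (R : realType)
    (C : set (probability T R)) : Prop :=
  forall (t : {i01 R}) (mu nu : probability T R),
    C mu -> C nu -> C (mixture t mu nu).

Definition concave_on d (T : measurableType d) (R : realType)
    (C : set (probability T R)) (F : probability T R -> \bar R) : Prop :=
  forall (t : {i01 R}) (mu nu : probability T R),
    C mu -> C nu ->
    t%:num%:E * F mu + (1 - t%:num)%R%:E * F nu <= F (mixture t mu nu).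

Definition similarity_kernel (R : realType) (K : R -> R -> R) : Prop :=
  [/\ measurable_fun setT
        (fun st : measurableTypeR R * measurableTypeR R => K st.1 st.2),
      forall s t, K s t = K t s,
      forall s t, (0 <= K s t <= 1)%R
    & forall s, K s s = 1%R].

(* [lne] is the extended logarithm, with [lne 0 = -oo]. *)
Definition entropy (R : realType) (K : R -> R -> R)
    (mu : borel_probability R) : \bar R :=
  \int[mu]_s (- lne (\int[mu]_t (K s t)%:E)).

Definition laplace_kernel (R : realType) (s t : R) : R := (expR (- `|s - t|))%R.

Definition finite_first_moment (R : realType) : set (borel_probability R) :=
  [set mu : borel_probability R | \int[mu]_s (`|s|%R)%:E < +oo].

Lemma laplace_similarity_kernel (R : realType) :
  similarity_kernel (@laplace_kernel R).
Proof.
rewrite /laplace_kernel; split=> [|s t|s t|s].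
- apply: measurableT_comp; first exact: measurable_expR.
  apply: measurableT_comp; first exact: oppr_measurable.
  apply: measurableT_comp; first exact: normr_measurable.
  by apply: measurable_funB; [exact: measurable_fst|exact: measurable_snd].
- by rewrite distrC.
- by rewrite expR_ge0 -expR0 ler_expR oppr_le0 normr_ge0.
- by rewrite subrr normr0 oppr0 expR0.
Qed.

Lemma convex_finite_first_moment (R : realType) :
  convex_class (@finite_first_moment R).
Proof.
move=> t mu nu; rewrite /finite_first_moment /= => hmu hnu.
have mabs : measurable_fun (setT : set (measurableTypeR R))
    (fun s : measurableTypeR R => (`|s|%R)%:E).
  by apply/measurable_EFinP; exact: normr_measurable.
rewrite ge0_integral_measure_add// !ge0_integral_mscale//.
by apply: lte_add_pinfty; apply: lte_mul_pinfty.
Qed.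

(* Main.v *)
Require Import Defs.
From mathcomp Require Import all_boot all_order all_algebra.
From mathcomp Require Import all_classical all_reals all_analysis.
From mathcomp Require Import measurable_realfun ring lra.

Set Implicit Arguments.
Unset Strict Implicit.
Unset Printing Implicit Defensive.

Import Order.TTheory GRing.Theory Num.Theory.
Import numFieldNormedType.Exports.

Local Open Scope classical_set_scope.
Local Open Scope ring_scope.
Local Open Scope ereal_scope.

(** Write u_nu(x) for the potential int exp(-|x - t|) dnu(t), so that the entropy
    of nu is the integral of the surprise -ln u_nu against nu. Since
    exp(-|x - t|) is, up to the factor 2, the Green function of 1 - d^2/dx^2,
    formally 2 nu = u_nu - u_nu'', and integrating by parts the entropy becomes
      - 1/2 int u ln u dx - 1/2 int (u')^2 / u dx,
    a sum of two functionals that are concave in u, hence in nu.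

    For a general measure u is only Lipschitz, so the argument below is a
    discrete and first order version of this computation. Concavity follows from
    a tangent inequality, valid for all nu and mu with a finite first moment
    ([entropy_tangent_le]):
      H(nu) + int (u_nu / u_mu) dmu <= 1 + int (- ln u_mu) dnu.
    Indeed, for mu = t nu0 + (1 - t) nu1 one averages the inequalities for nu0
    and nu1: the ratios u_nu0 / u_mu and u_nu1 / u_mu average to 1, so the two
    units cancel, and the right-hand sides average to H(mu).

    The tangent inequality rests on two facts.
    - The second difference with step h of exp(-|x|), weighted so as to kill
      exp(x) and exp(-x), is supported in [-h, h]: it is minus the positive part
      of 2 sinh(h - |x|) ([laplace_second_difference]). Integrating a function F
      against u_nu and translating the Lebesgue measure therefore expresses the
      integral of F, mollified at scale h, against nu ([integral_potential_smear]).
    - The exponential is convex. With r = u_nu / u_mu = exp(g - f), the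
      inequality exp(a) (a - b) - exp(a) + exp(b) >= 0 applied at x and at its
      neighbours x - h and x + h gives the mollified tangent inequality
      ([smear_tangent]).
    Finally ln u is 1-Lipschitz, so mollifying costs O(h), and h tends to 0
    ([entropy_tangent_le_scale]). The first moment makes all the Lebesgue
    integrals finite ([integral_linear_growth_fin]): they can be subtracted. *)

(** * Translation invariance of the Lebesgue measure *)

Section lebesgue_translation.
Context {R : realType}.
Local Notation lam := (@lebesgue_measure R).

Lemma measurable_shift (a : R) :
  measurable_fun setT (fun x : measurableTypeR R => (x + a)%R : measurableTypeR R).
Proof. by apply: measurable_funD. Qed.

Lemma ge0_integral_shift (a : R) (f : R -> \bar R) :
  measurable_fun setT f -> (forall x, 0 <= f x) ->
  \int[lam]_x f (x + a)%R = \int[lam]_x f x.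
Proof.
move=> mf f0.
have := @ge0_integral_pushforward _ _ _ _ R _ (measurable_shift a)
  lam setT f measurableT mf (fun x _ => f0 x).
rewrite preimage_setT => <-; apply: eq_measure_integral => //= [|mphi A mA _].
  exact: measurable_shift.
apply/esym/lebesgue_measure_unique => //=.
move=> _ [[b c]] _ <-; rewrite /pushforward.
rewrite (_ : _ @^-1` _ = `](b - a)%R, (c - a)%R]%classic); last first.
  by apply/seteqP; split => x /=; rewrite !in_itv/= ltrBlDr lerBrDr.
rewrite !lebesgue_measure_itv/= !lte_fin ltrD2r -!EFinB.
by case: ifP => // _; congr EFin; ring.
Qed.

End lebesgue_translation.

Lemma integral_probability_cst d (T : measurableType d) (R : realType)
    (P : probability T R) (c : R) : \int[P]_x c%:E = c%:E.
Proof. by rewrite integral_cst//= probability_setT mule1. Qed.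

(** * The potential of a probability measure *)

Section laplace_potential.
Context {R : realType}.
Local Notation lam := (@lebesgue_measure R).
Implicit Types (nu mu : borel_probability R) (x y s h : R).

Definition potential nu (x : R) : R :=
  fine (\int[nu]_t (laplace_kernel x t)%:E).

Lemma laplace_ge0 x y : (0 <= laplace_kernel x y)%R.
Proof. exact: expR_ge0. Qed.

Lemma laplace_le1 x y : (laplace_kernel x y <= 1)%R.
Proof. by rewrite /laplace_kernel -expR0 ler_expR oppr_le0. Qed.

Lemma measurable_laplace2 :
  measurable_fun setT (fun z : measurableTypeR R * measurableTypeR R =>
    (laplace_kernel z.1 z.2)%:E).
Proof. by apply/measurable_EFinP; case: (laplace_similarity_kernel R). Qed.

Lemma measurable_laplace x :
  measurable_fun setT (fun t : measurableTypeR R => (laplace_kernel x t)%:E).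
Proof.
exact: (measurableT_comp measurable_laplace2 (measurable_pair1 x)).
Qed.

Lemma potentialE nu x :
  (potential nu x)%:E = \int[nu]_t (laplace_kernel x t)%:E.
Proof.
rewrite fineK// ge0_fin_numE; last first.
  by apply: integral_ge0 => t _; rewrite lee_fin laplace_ge0.
apply: (@le_lt_trans _ _ (\int[nu]_t 1%:E)); last first.
  by rewrite integral_probability_cst ltry.
apply: ge0_le_integral => //.
- by move=> t _; rewrite lee_fin laplace_ge0.
- exact: measurable_laplace.
- by move=> t _; rewrite lee_fin laplace_le1.
Qed.

(** A nonnegative function of zero integral vanishes almost everywhere, whereas
    the kernel vanishes nowhere and nu has mass one. *)
Lemma potential_gt0 nu x : (0 < potential nu x)%R.
Proof.
rewrite -lte_fin potentialE lt_neqAle integral_ge0 ?andbT; last first.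
  by move=> t _; rewrite lee_fin laplace_ge0.
apply/negP => /eqP /esym I0.
have : \int[nu]_t `|(laplace_kernel x t)%:E| = 0.
  rewrite -[RHS]I0; apply: eq_integral => t _.
  by rewrite gee0_abs// lee_fin laplace_ge0.
move/(ae_eq_integral_abs nu measurableT (measurable_laplace x)).
move=> [N [mN N0 sN]].
have : nu setT <= nu N.
  apply: le_measure; rewrite ?inE// => t _; apply: sN => /= abs0.
  have [K0] := abs0 I.
  by have := expR_gt0 (- `|x - t|)%R; rewrite [expR _]K0 ltxx.
by rewrite [X in _ <= X]N0 [X in X <= _](probability_setT nu) lee_fin ler10.
Qed.

Lemma potential_le1 nu x : (potential nu x <= 1)%R.
Proof.
rewrite -lee_fin potentialE.
rewrite -(integral_probability_cst nu).
apply: ge0_le_integral => //.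
- by move=> t _; rewrite lee_fin laplace_ge0.
- exact: measurable_laplace.
- by move=> t _; rewrite lee_fin laplace_le1.
Qed.

(** The triangle inequality bounds the kernels at x and at y by each other, up to
    the factor exp |x - y|; this makes the logarithm of the potential 1-Lipschitz. *)
Lemma potential_harnack nu x y :
  (potential nu x <= expR `|x - y| * potential nu y)%R.
Proof.
rewrite -lee_fin EFinM !potentialE -ge0_integralZl_EFin ?expR_ge0//; last 2 first.
- by move=> t _; rewrite lee_fin laplace_ge0.
- exact: measurable_laplace.
apply: ge0_le_integral => //.
- by move=> t _; rewrite lee_fin laplace_ge0.
- exact: measurable_laplace.
- by apply: emeasurable_funM => //; exact: measurable_laplace.
- move=> t _; rewrite -EFinM lee_fin /laplace_kernel -expRD ler_expR.
  have := ler_distD x y t; rewrite (distrC y x); lra.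
Qed.

Lemma measurable_potential nu : measurable_fun setT (potential nu).
Proof.
apply: measurableT_comp => //.
exact: (@measurable_fun_fubini_tonelli_F _ _ (measurableTypeR R) (measurableTypeR R) R nu
  (fun z => (laplace_kernel z.1 z.2)%:E) measurable_laplace2
  (fun z => laplace_ge0 z.1 z.2)).
Qed.

Definition surprise nu (x : R) : R := (- ln (potential nu x))%R.

Lemma surprise_ge0 nu x : (0 <= surprise nu x)%R.
Proof. by rewrite oppr_ge0 ln_le0// potential_le1. Qed.

(** This Lipschitz bound controls both the mollification error and, with x far
    away, the growth at infinity. *)
Lemma surprise_lipschitz nu x y :
  (surprise nu x <= surprise nu y + `|x - y|)%R.
Proof.
have : (ln (potential nu y) <= ln (expR `|x - y| * potential nu x))%R.
  rewrite ler_ln ?posrE ?potential_gt0// ?mulr_gt0 ?expR_gt0 ?potential_gt0//.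
  by rewrite distrC potential_harnack.
rewrite lnM ?posrE ?potential_gt0 ?expR_gt0// expRK /surprise; lra.
Qed.

Lemma measurable_surprise nu : measurable_fun setT (surprise nu).
Proof.
apply: measurableT_comp; first exact: oppr_measurable.
apply: measurableT_comp; first exact: measurable_ln.
exact: measurable_potential.
Qed.

Lemma entropyE nu :
  entropy (@laplace_kernel R) nu = \int[nu]_x (surprise nu x)%:E.
Proof.
apply: eq_integral => x _.
by rewrite -potentialE lne_EFin ?potential_gt0.
Qed.

Lemma integral_surprise_fin nu mu : finite_first_moment nu ->
  \int[nu]_x (surprise mu x)%:E < +oo.
Proof.
rewrite /finite_first_moment/= => nu1.
have mabs : measurable_fun (setT : set (measurableTypeR R)) (fun s : R => (`|s|%R)%:E).
  by apply/measurable_EFinP; exact: normr_measurable.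
apply: (@le_lt_trans _ _ (\int[nu]_x ((surprise mu 0)%:E + (`|x|%R)%:E))).
  apply: ge0_le_integral => //.
  - by move=> x _; rewrite lee_fin surprise_ge0.
  - by apply/measurable_EFinP; exact: measurable_surprise.
  - exact: emeasurable_funD.
  - move=> x _; rewrite -EFinD lee_fin.
    by have := surprise_lipschitz mu x 0; rewrite subr0.
rewrite ge0_integralD//; last by move=> x _; rewrite lee_fin surprise_ge0.
rewrite integral_probability_cst.
by apply: lte_add_pinfty => //; rewrite ltry.
Qed.

End laplace_potential.

(** * Second differences of the potential *)

Section smearing.
Context {R : realType}.
Local Notation lam := (@lebesgue_measure R).
Implicit Types (nu mu : borel_probability R) (x y s h : R) (F G : R -> R).

(** The positive part of 2 sinh(h - |y|). *)
Definition tent h y : R := Num.max 0%R (expR (h - `|y|) - expR (`|y| - h))%R.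

Lemma tent_ge0 h y : (0 <= tent h y)%R.
Proof. by rewrite /tent le_max lexx. Qed.

Lemma tent_eq0 h y : (h <= `|y|)%R -> tent h y = 0%R.
Proof.
move=> hy; apply/max_idPl; rewrite subr_le0 ler_expR; lra.
Qed.

Lemma measurable_tent h : measurable_fun setT (tent h).
Proof.
have mabs : measurable_fun setT (fun y : R => `|y|%R) by exact: normr_measurable.
apply: measurable_maxr => //; apply: measurable_funB; apply: measurableT_comp => //;
  apply: measurable_funB => //.
Qed.

(** Away from the origin exp(-|y|) is an eigenfunction of the shift by h and of
    its inverse, with eigenvalues exp(h) and exp(-h), so the weighted second
    difference vanishes unless the kink of the absolute value lies between
    y - h and y + h. *)
Lemma laplace_second_difference h x s : (0 <= h)%R ->
  ((expR h + expR (- h)) * laplace_kernel x s =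
   laplace_kernel (x - h) s + laplace_kernel (x + h) s + tent h (x - s))%R.
Proof.
move=> h0; rewrite /laplace_kernel.
rewrite (addrAC x (- h) (- s))%R (addrAC x h (- s))%R.
set y := (x - s)%R; rewrite mulrDl -!expRD.
wlog y0 : y / (0 <= y)%R.
  move=> wl; have [/wl//|/ltW y0] := leP 0%R y.
  have := wl (- y)%R; rewrite oppr_ge0 => /(_ y0).
  have -> : (`|- y - h| = `|y + h|)%R by rewrite -opprD normrN.
  have -> : (`|- y + h| = `|y - h|)%R by rewrite -normrN opprD opprK.
  by rewrite /tent normrN => ->; rewrite [in RHS](addrC (expR (- `|y - h|)%R)).
rewrite (ger0_norm y0) (ger0_norm (addr_ge0 y0 h0)) (addrC (expR (h - y))).
have -> : (- (y + h) = - h - y)%R by ring.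
rewrite [X in _ = (X + _)%R]addrC -addrA; congr (_ + _)%R.
have [hy|yh] := leP h y.
  rewrite tent_eq0 ?ger0_norm// ?subr_ge0// addr0; congr expR; ring.
rewrite /tent (ger0_norm y0) ler0_norm ?subr_le0 1?ltW// opprK.
rewrite (_ : Num.max _ _ = expR (h - y) - expR (y - h))%R; first by ring.
by apply/max_idPr; rewrite subr_ge0 ler_expR; lra.
Qed.

Lemma potential_second_difference nu h x : (0 <= h)%R ->
  ((expR h + expR (- h)) * potential nu x)%:E =
  (potential nu (x - h) + potential nu (x + h))%:E +
  \int[nu]_s (tent h (x - s))%:E.
Proof.
move=> h0.
have mt : measurable_fun setT (fun s : measurableTypeR R => (tent h (x - s))%:E).
  apply/measurable_EFinP; apply: measurableT_comp; first exact: measurable_tent.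
  exact: measurable_funB.
have l0 z s : 0 <= (@laplace_kernel R z s)%:E by rewrite lee_fin laplace_ge0.
rewrite EFinM (EFinD (potential nu _)) !potentialE -ge0_integralZl_EFin ?addr_ge0 ?expR_ge0//;
  last exact: measurable_laplace.
rewrite -ge0_integralD//; [|exact: measurable_laplace..].
rewrite -ge0_integralD//; last 3 first.
- by move=> s _; rewrite adde_ge0.
- by apply: emeasurable_funD; exact: measurable_laplace.
- by move=> s _; rewrite lee_fin tent_ge0.
by apply: eq_integral => s _; rewrite -EFinM laplace_second_difference.
Qed.

(** The integral against nu of F convolved with the tent of width h; the tent is
    not normalized. *)
Definition smear F h nu : \bar R :=
  \int[nu]_s \int[lam]_y (F (s + y) * tent h y)%:E.

(** Summation by parts: the Lebesgue integral of F times a second difference of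
    the potential, where translation invariance moves the shifts onto F and
    Fubini turns the tent integrated against nu into a mollification of F. *)
Lemma integral_potential_smear F h nu : (0 <= h)%R ->
    measurable_fun setT F -> (forall x, 0 <= F x)%R ->
  (expR h + expR (- h))%:E * \int[lam]_x (F x * potential nu x)%:E =
  \int[lam]_x ((F (x + h) + F (x - h)) * potential nu x)%:E + smear F h nu.
Proof.
move=> h0 mF F0.
have mu_ := measurable_potential nu.
have u0 x : (0 <= potential nu x)%R by exact/ltW/potential_gt0.
have msh a : measurable_fun setT (fun x : R => x + a)%R by exact: measurable_shift.
have mFu a : measurable_fun setT (fun x => (F x * potential nu (x + a))%:E).
  apply/measurable_EFinP; apply: measurable_funM => //.
  exact: measurableT_comp.
have mFu' a : measurable_fun setT (fun x => (F (x + a) * potential nu x)%:E).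
  apply/measurable_EFinP; apply: measurable_funM => //.
  exact: measurableT_comp.
have mFt : measurable_fun setT
    (fun z : measurableTypeR R * measurableTypeR R => (F z.1 * tent h (z.1 - z.2))%:E).
  apply/measurable_EFinP; apply: measurable_funM.
    exact: measurableT_comp.
  apply: measurableT_comp; first exact: measurable_tent.
  exact: measurable_funB.
have Ft0 (z : measurableTypeR R * measurableTypeR R) :
    0 <= (F z.1 * tent h (z.1 - z.2))%:E by rewrite lee_fin mulr_ge0 ?tent_ge0.
transitivity (\int[lam]_x ((F x * potential nu (x - h))%:E +
    (F x * potential nu (x + h))%:E + \int[nu]_s (F x * tent h (x - s))%:E)).
  rewrite -ge0_integralZl_EFin ?addr_ge0 ?expR_ge0//; last 2 first.
  - by move=> x _; rewrite lee_fin mulr_ge0.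
  - by apply/measurable_EFinP; exact: measurable_funM.
  apply: eq_integral => x _.
  rewrite -EFinM mulrCA EFinM potential_second_difference// ge0_muleDr; last 2 first.
  - by rewrite lee_fin addr_ge0.
  - by apply: integral_ge0 => s _; rewrite lee_fin tent_ge0.
  congr (_ + _); first by rewrite -EFinM mulrDr.
  rewrite -ge0_integralZl_EFin//.
    by move=> s _; rewrite lee_fin tent_ge0.
  apply/measurable_EFinP; apply: measurableT_comp; first exact: measurable_tent.
  exact: measurable_funB.
rewrite ge0_integralD//; last 4 first.
- by move=> x _; rewrite adde_ge0// lee_fin mulr_ge0.
- exact: emeasurable_funD (mFu _) (mFu h).
- by move=> x _; apply: integral_ge0 => s _; exact: (Ft0 (x, s)).
- exact: (@measurable_fun_fubini_tonelli_F _ _ (measurableTypeR R)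
    (measurableTypeR R) R nu _ mFt Ft0).
congr (_ + _).
  have Fu0r a x : 0 <= (F x * potential nu (x + a))%:E by rewrite lee_fin mulr_ge0.
  have Fu0l a x : 0 <= (F (x + a) * potential nu x)%:E by rewrite lee_fin mulr_ge0.
  have E1 : \int[lam]_x (F x * potential nu (x - h))%:E =
      \int[lam]_x (F (x + h) * potential nu x)%:E.
    apply: etrans (esym (ge0_integral_shift h (mFu (- h)%R) (Fu0r (- h)%R))) _.
    by apply: eq_integral => x _; rewrite addrK.
  have E2 : \int[lam]_x (F x * potential nu (x + h))%:E =
      \int[lam]_x (F (x - h) * potential nu x)%:E.
    apply: etrans (esym (ge0_integral_shift (- h)%R (mFu h) (Fu0r h))) _.
    by apply: eq_integral => x _; rewrite subrK.
  rewrite (ge0_integralD lam measurableT (fun x _ => Fu0r (- h)%R x) (mFu _)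
    (fun x _ => Fu0r h x) (mFu h)).
  under [RHS]eq_integral do rewrite mulrDl EFinD.
  rewrite (ge0_integralD lam measurableT (fun x _ => Fu0l h x) (mFu' h)
    (fun x _ => Fu0l (- h)%R x) (mFu' _)).
  by rewrite E1 E2.
apply: etrans (fubini_tonelli _ mFt Ft0) _.
apply: eq_integral => s _.
apply: etrans (esym (ge0_integral_shift s
  (measurableT_comp mFt (measurable_pair2 s)) (fun x => Ft0 (x, s)))) _.
by apply: eq_integral => y _; rewrite /= addrK addrC.
Qed.

End smearing.

(** * Mollification at scale h *)

Section smearing_bounds.
Context {R : realType}.
Local Notation lam := (@lebesgue_measure R).
Implicit Types (nu mu : borel_probability R) (x y s h : R) (F G : R -> R).

Let mtentE h : measurable_fun (setT : set (measurableTypeR R)) (fun y => (tent h y)%:E).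
Proof. by apply/measurable_EFinP; exact: measurable_tent. Qed.

Definition tent_mass h : \bar R := \int[lam]_y (tent h y)%:E.

(** On [0, h / 2] the tent is at least h / 2, because exp(z) - exp(-z) >= z. *)
Lemma tent_mass_gt0 h : (0 < h)%R -> 0 < tent_mass h.
Proof.
move=> h0; apply: (@lt_le_trans _ _ (\int[lam]_(y in `[0%R, (h / 2)%R]) (h / 2)%:E)).
  rewrite integral_cst//= lebesgue_measure_itv/= lte_fin divr_gt0//.
  by rewrite oppr0 adde0 -EFinM lte_fin mulr_gt0// divr_gt0.
apply: (@le_trans _ _ (\int[lam]_(y in `[0%R, (h / 2)%R]) (tent h y)%:E)).
  apply: ge0_le_integral => //.
  - by move=> y _; rewrite lee_fin divr_ge0// ltW.
  - exact: measurable_funTS.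
  - move=> y /=; rewrite in_itv/= => /andP[y0 yh].
    rewrite lee_fin /tent ger0_norm// le_max; apply/orP; right.
    have := expR_ge1Dx (h - y).
    have -> : (y - h = - (h - y))%R by ring.
    have : (expR (- (h - y)) <= 1)%R by rewrite expR_le1; lra.
    lra.
by apply: ge0_subset_integral => //= y _; rewrite lee_fin tent_ge0.
Qed.

Lemma tent_mass_fin h : (0 <= h)%R -> tent_mass h \is a fin_num.
Proof.
move=> h0; rewrite ge0_fin_numE; last first.
  by apply: integral_ge0 => y _; rewrite lee_fin tent_ge0.
apply: (@le_lt_trans _ _ (\int[lam]_(y in `[(- h)%R, h]) (expR h)%:E)); last first.
  rewrite integral_cst//= lebesgue_measure_itv/=.
  by case: ifP => _; rewrite ?mule0 ?ltry// -EFinB -EFinM ltry.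
rewrite [leRHS]integral_mkcond; apply: ge0_le_integral => //.
- by move=> y _; rewrite lee_fin tent_ge0.
- apply/(measurable_restrictT _ _).1 => //.
- move=> y _; rewrite patchE; case: ifPn => [_|].
    rewrite lee_fin /tent ge_max expR_ge0/=.
    have := expR_gt0 (`|y| - h).
    have : (expR (h - `|y|) <= expR h)%R by rewrite ler_expR gerBl.
    lra.
  rewrite notin_setE/= in_itv/= => hy; rewrite tent_eq0//.
  by rewrite leNgt; apply/negP => /ltW; rewrite ler_norml.
Qed.

Let mshiftF F : measurable_fun setT F -> measurable_fun setT
  (fun z : measurableTypeR R * measurableTypeR R => F (z.1 + z.2)%R).
Proof. by move=> mF; apply: measurableT_comp => //; exact: measurable_funD. Qed.

Let measurable_smear_integrand F h : measurable_fun setT F ->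
  measurable_fun setT (fun z : measurableTypeR R * measurableTypeR R =>
    (F (z.1 + z.2) * tent h z.2)%:E).
Proof.
move=> mF; apply/measurable_EFinP; apply: measurable_funM.
  exact: mshiftF.
by apply: measurableT_comp => //; exact: measurable_tent.
Qed.

Let mslice F h s : measurable_fun setT F ->
  measurable_fun (setT : set (measurableTypeR R)) (fun y => (F (s + y) * tent h y)%:E).
Proof.
move=> mF.
exact: (measurableT_comp (measurable_smear_integrand h mF) (measurable_pair1 s)).
Qed.

Let msmear F h : measurable_fun setT F -> (forall x, 0 <= F x)%R ->
  measurable_fun (setT : set (measurableTypeR R))
    (fun s => \int[lam]_y (F (s + y) * tent h y)%:E).
Proof.
move=> mF F0; have p0 (z : measurableTypeR R * measurableTypeR R) :
    0 <= (F (z.1 + z.2) * tent h z.2)%:E by rewrite lee_fin mulr_ge0 ?tent_ge0.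
exact: (measurable_fun_fubini_tonelli_F _ (measurable_smear_integrand h mF) p0).
Qed.

Let tent_massZ (c : R) h : (0 <= c)%R ->
  tent_mass h * c%:E = \int[lam]_y (c * tent h y)%:E.
Proof.
move=> c0; rewrite muleC -ge0_integralZl_EFin//.
by move=> y _; rewrite lee_fin tent_ge0.
Qed.

Let integral_tent_mass nu G h : (0 <= h)%R -> measurable_fun setT G ->
    (forall x, 0 <= G x)%R ->
  tent_mass h * \int[nu]_s (G s)%:E = \int[nu]_s (tent_mass h * (G s)%:E).
Proof.
move=> h0 mG G0; rewrite ge0_integralZl//.
- exact/measurable_EFinP.
- by move=> s _; rewrite lee_fin.
- by apply: integral_ge0 => y _; rewrite lee_fin tent_ge0.
Qed.

Let mmass G h : measurable_fun setT G ->
  measurable_fun (setT : set (measurableTypeR R)) (fun s => tent_mass h * (G s)%:E).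
Proof.
by move=> mG; apply: emeasurable_funM => //; exact/measurable_EFinP.
Qed.

(** Only the values of F within distance h of s enter the mollification at s. *)
Lemma smear_ge F G h nu : (0 <= h)%R ->
    measurable_fun setT F -> (forall x, 0 <= F x)%R ->
    measurable_fun setT G -> (forall x, 0 <= G x)%R ->
    (forall s y, `|y| <= h -> G s <= F (s + y))%R ->
  tent_mass h * \int[nu]_s (G s)%:E <= smear F h nu.
Proof.
move=> h0 mF F0 mG G0 GF; rewrite integral_tent_mass//.
have M0 : 0 <= tent_mass h.
  by apply: integral_ge0 => y _; rewrite lee_fin tent_ge0.
apply: ge0_le_integral => //.
- by move=> s _; rewrite mule_ge0// lee_fin.
- exact: mmass.
- exact: msmear.
- move=> s _; rewrite tent_massZ//; apply: ge0_le_integral => //.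
  + by move=> y _; rewrite lee_fin mulr_ge0// tent_ge0.
  + by apply/measurable_EFinP; apply: measurable_funM => //; exact: measurable_tent.
  + exact: mslice.
  + move=> y _; rewrite lee_fin; have [yh|/ltW hy] := leP `|y|%R h.
      by rewrite ler_wpM2r ?tent_ge0// GF.
    by rewrite tent_eq0// !mulr0.
Qed.

Lemma smear_le F G h nu : (0 <= h)%R ->
    measurable_fun setT F -> (forall x, 0 <= F x)%R ->
    measurable_fun setT G -> (forall x, 0 <= G x)%R ->
    (forall s y, `|y| <= h -> F (s + y) <= G s)%R ->
  smear F h nu <= tent_mass h * \int[nu]_s (G s)%:E.
Proof.
move=> h0 mF F0 mG G0 FG; rewrite integral_tent_mass//.
apply: ge0_le_integral => //.
- move=> s _; apply: integral_ge0 => y _.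
  by rewrite lee_fin mulr_ge0// tent_ge0.
- exact: msmear.
- exact: mmass.
- move=> s _; rewrite tent_massZ//; apply: ge0_le_integral => //.
  + by move=> y _; rewrite lee_fin mulr_ge0// tent_ge0.
  + exact: mslice.
  + by apply/measurable_EFinP; apply: measurable_funM => //; exact: measurable_tent.
  + move=> y _; rewrite lee_fin; have [yh|/ltW hy] := leP `|y|%R h.
      by rewrite ler_wpM2r ?tent_ge0// FG.
    by rewrite tent_eq0// !mulr0.
Qed.

End smearing_bounds.

(** * Integrability against a potential *)

Section integrability.
Context {R : realType}.
Local Notation lam := (@lebesgue_measure R).
Implicit Types (nu mu : borel_probability R) (x y s h : R) (F G : R -> R).

(** A square root of exp(-|y|). *)
Let decay (y : R) : R := expR (- (`|y| / 2)).

Let decay_cont : continuous decay.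
Proof.
move=> y; apply: continuous_comp; last exact: continuous_expR.
apply: continuousN; apply: (@continuousM _ R); last exact: cst_continuous.
exact: norm_continuous.
Qed.

Let mdecay : measurable_fun setT decay.
Proof. exact: continuous_measurable_fun. Qed.

Let integral_decay_fin : \int[lam]_y (decay y)%:E < +oo.
Proof.
rewrite ge0_symfun_integralT//; last 2 first.
- by move=> y; exact: expR_ge0.
- by move=> y; rewrite /decay /= normrN.
apply: lte_mul_pinfty => //; rewrite -set_itvcy.
apply: (@le_lt_trans _ _ (\int[lam]_y (2%:E * (exponential_pdf (2^-1 : R) y)%:E))).
  rewrite [leLHS]integral_mkcond; apply: ge0_le_integral => //.
  - by move=> y _; rewrite patchE; case: ifP => // _; rewrite lee_fin expR_ge0.
  - apply/(measurable_restrictT _ _).1 => //; apply: measurable_funTS.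
    exact/measurable_EFinP.
  - apply: emeasurable_funM => //; apply/measurable_EFinP.
    exact: measurable_exponential_pdf.
  - move=> y _; rewrite patchE; case: ifPn => [|_].
      rewrite inE/= in_itv/= andbT => y0.
      rewrite exponential_pdfE// -EFinM lee_fin /decay ger0_norm//.
      rewrite mulrA divff// mul1r le_eqVlt; apply/orP; left; apply/eqP.
      by congr expR; field.
    by rewrite -EFinM lee_fin mulr_ge0// exponential_pdf_ge0// invr_ge0.
rewrite ge0_integralZl_EFin//; last 2 first.
- by move=> y _; rewrite lee_fin exponential_pdf_ge0// invr_ge0.
- by apply/measurable_EFinP; exact: measurable_exponential_pdf.
by rewrite integral_exponential_pdf// ?invr_gt0// mule1 ltry.
Qed.

(** After Fubini and the translation x = s + y, the growth |s| of F is integrable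
    by the first moment, and the growth |y| is absorbed by half of the decay of
    exp(-|y|). *)
Lemma integral_linear_growth_fin F (a : R) nu : finite_first_moment nu ->
    measurable_fun setT F -> (forall x, 0 <= F x)%R ->
    (forall x, F x <= a + `|x|)%R ->
  \int[lam]_x (F x * potential nu x)%:E < +oo.
Proof.
rewrite /finite_first_moment/= => nu1 mF F0 Fa.
have mabs : measurable_fun (setT : set (measurableTypeR R)) (fun s : R => (`|s|%R)%:E).
  by apply/measurable_EFinP; exact: normr_measurable.
have a0 : (0 <= a)%R by have := Fa 0%R; rewrite normr0; have := F0 0%R; lra.
have mFl : measurable_fun setT
    (fun z : measurableTypeR R * measurableTypeR R => (F z.1 * laplace_kernel z.1 z.2)%:E).
  apply/measurable_EFinP; apply: measurable_funM.
    exact: measurableT_comp.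
  by case: (laplace_similarity_kernel R).
have Fl0 (z : measurableTypeR R * measurableTypeR R) :
  0 <= (F z.1 * laplace_kernel z.1 z.2)%:E by rewrite lee_fin mulr_ge0// laplace_ge0.
have -> : \int[lam]_x (F x * potential nu x)%:E =
    \int[lam]_x \int[nu]_s (F x * laplace_kernel x s)%:E.
  apply: eq_integral => x _; rewrite EFinM potentialE -ge0_integralZl_EFin//.
    by move=> s _; rewrite lee_fin laplace_ge0.
  exact: measurable_laplace.
have -> : \int[lam]_x \int[nu]_s (F x * laplace_kernel x s)%:E =
    \int[nu]_s \int[lam]_x (F x * laplace_kernel x s)%:E.
  exact: (fubini_tonelli _ mFl Fl0).
have C0 : 0 <= \int[lam]_y (decay y)%:E.
  by apply: integral_ge0 => y _; rewrite lee_fin expR_ge0.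
apply: (@le_lt_trans _ _
    (\int[nu]_s ((a + 2)%:E + (`|s|%R)%:E) * \int[lam]_y (decay y)%:E)).
  rewrite -ge0_integralZr//; last 2 first.
  - exact: emeasurable_funD.
  - by move=> s _; rewrite -EFinD lee_fin !addr_ge0.
  apply: ge0_le_integral => //.
  - by move=> s _; apply: integral_ge0 => x _; exact: (Fl0 (x, s)).
  - exact: (@measurable_fun_fubini_tonelli_G _ _ (measurableTypeR R)
      (measurableTypeR R) R lam _ mFl Fl0).
  - by apply: emeasurable_funM => //; exact: emeasurable_funD.
  - move=> s _; have ms := measurableT_comp mFl (measurable_pair2 s).
    have <- : \int[lam]_y (F (y + s) * laplace_kernel (y + s) s)%:E =
        \int[lam]_y (F y * laplace_kernel y s)%:E.
      exact: (ge0_integral_shift s ms (fun x => Fl0 (x, s))).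
    rewrite -EFinD -ge0_integralZl_EFin ?addr_ge0//; last 2 first.
    + by move=> y _; rewrite lee_fin expR_ge0.
    + exact/measurable_EFinP.
    apply: ge0_le_integral => //.
    + by move=> y _; exact: (Fl0 ((y + s)%R, s)).
    + exact: (measurableT_comp ms (measurable_shift s)).
    + by apply: emeasurable_funM => //; exact/measurable_EFinP.
    + move=> y _; rewrite -EFinM lee_fin /laplace_kernel /= addrK.
      have -> : (expR (- `|y|) = decay y * decay y)%R.
        by rewrite -expRD; congr expR; field.
      rewrite mulrA ler_wpM2r ?expR_ge0//.
      have d0 : (0 < decay y)%R by exact: expR_gt0.
      have d1 : (decay y <= 1)%R by rewrite expR_le1 oppr_le0 divr_ge0.
      have dy : (`|y| * decay y <= 2)%R.
        rewrite /decay expRN ler_pdivrMr ?expR_gt0//.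
        by have := expR_ge1Dx (`|y| / 2); lra.
      apply: (@le_trans _ _ ((a + `|s| + `|y|) * decay y)%R).
        rewrite ler_wpM2r ?expR_ge0// (le_trans (Fa _))// -addrA lerD2l addrC.
        exact: ler_normD.
      rewrite mulrDl; have : ((a + `|s|) * decay y <= (a + `|s|) * 1)%R.
        by rewrite ler_wpM2l// addr_ge0.
      lra.
apply: lte_mul_pinfty => //.
- by apply: integral_ge0 => s _; rewrite -EFinD lee_fin !addr_ge0.
- rewrite ge0_integralD//; last by move=> s _; rewrite lee_fin addr_ge0.
  rewrite integral_probability_cst ge0_fin_numE; last first.
    by rewrite adde_ge0 ?lee_fin ?addr_ge0// integral_ge0.
  by apply: lte_add_pinfty => //; rewrite ltry.
Qed.

End integrability.

(** * The mollified tangent inequality *)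

Section tangent.
Context {R : realType}.
Local Notation lam := (@lebesgue_measure R).
Implicit Types (nu mu : borel_probability R) (x y s h : R) (F G : R -> R).

(** The graph of the exponential lies above its tangent at a, evaluated at b. *)
Lemma expR_bregman_ge0 (a b : R) : (0 <= expR a * (a - b) - expR a + expR b)%R.
Proof.
have -> : (expR b = expR a * expR (b - a))%R by rewrite -expRD; congr expR; ring.
have -> : (expR a * (a - b) - expR a + expR a * expR (b - a) =
  expR a * (expR (b - a) - (1 + (b - a))))%R by ring.
by rewrite mulr_ge0 ?expR_ge0// subr_ge0 expR_ge1Dx.
Qed.

(** The difference of the two sides is u times a combination, with the nonnegative
    weights c - 2, 1 and 1, of the convexity defects of the exponential between
    g - f and respectively 0, g1 - f1 and g2 - f2. Here f and g are the values at
    a point, the indices 1 and 2 refer to its two neighbours, and the sides are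
    arranged so that all terms are nonnegative when f and g are. *)
Lemma second_difference_exp_convex (c u v f f1 f2 g g1 g2 : R) :
    (2 <= c)%R -> (0 <= u)%R ->
    v = (expR (g - f) * u)%R ->
  (c * (f * v) + (g1 + g2) * v + c * v + (1 + 1) * u <=
   c * (g * v) + (f1 + f2) * v + (expR (g1 - f1) + expR (g2 - f2)) * u
   + c * (1 * u))%R.
Proof.
move=> c2 u0 ->; rewrite -subr_ge0.
set r := expR (g - f).
have r0 : (0 <= r * ((g - f) - 0) - r + 1)%R.
  by rewrite -[X in (_ + X)%R]expR0; exact: expR_bregman_ge0.
have r1 : (0 <= r * ((g - f) - (g1 - f1)) - r + expR (g1 - f1))%R.
  exact: expR_bregman_ge0.
have r2 : (0 <= r * ((g - f) - (g2 - f2)) - r + expR (g2 - f2))%R.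
  exact: expR_bregman_ge0.
have c20 : (0 <= c - 2)%R by lra.
have s0 := mulr_ge0 u0 (addr_ge0 (mulr_ge0 c20 r0) (addr_ge0 r1 r2)).
by apply: (le_trans s0); rewrite le_eqVlt; apply/orP; left; apply/eqP; ring.
Qed.

Lemma ge2_expRDexpRN h : (2 <= expR h + expR (- h))%R.
Proof. by have := expR_ge1Dx h; have := expR_ge1Dx (- h)%R; lra. Qed.

Lemma ge0_adde_fin (x y : \bar R) : 0 <= x -> 0 <= y -> x + y < +oo ->
  exists a b : R, x = a%:E /\ y = b%:E.
Proof. by case: x => [a||]//; case: y => [b||]// _ _ _; exists a, b. Qed.

Let intD (f g : R -> R) : measurable_fun setT f -> (forall x, 0 <= f x)%R ->
  measurable_fun setT g -> (forall x, 0 <= g x)%R ->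
  \int[lam]_x (f x + g x)%:E = \int[lam]_x (f x)%:E + \int[lam]_x (g x)%:E.
Proof.
move=> mf f0 mg g0; under eq_integral do rewrite EFinD.
apply: ge0_integralD => //; try (by move=> x _; rewrite lee_fin);
  exact/measurable_EFinP.
Qed.

Let intZ (c : R) (f : R -> R) : (0 <= c)%R -> measurable_fun setT f ->
  (forall x, 0 <= f x)%R ->
  \int[lam]_x (c * f x)%:E = c%:E * \int[lam]_x (f x)%:E.
Proof.
move=> c0 mf f0; under eq_integral do rewrite EFinM.
apply: ge0_integralZl_EFin => //; first by move=> x _; rewrite lee_fin.
exact/measurable_EFinP.
Qed.

Let intD4 (f1 f2 f3 f4 : R -> R) :
  measurable_fun setT f1 -> (forall x, 0 <= f1 x)%R ->
  measurable_fun setT f2 -> (forall x, 0 <= f2 x)%R ->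
  measurable_fun setT f3 -> (forall x, 0 <= f3 x)%R ->
  measurable_fun setT f4 -> (forall x, 0 <= f4 x)%R ->
  \int[lam]_x (f1 x + f2 x + f3 x + f4 x)%:E =
  \int[lam]_x (f1 x)%:E + \int[lam]_x (f2 x)%:E + \int[lam]_x (f3 x)%:E +
  \int[lam]_x (f4 x)%:E.
Proof.
move=> m1 p1 m2 p2 m3 p3 m4 p4.
have m12 : measurable_fun setT (fun x => f1 x + f2 x)%R by exact: measurable_funD.
have p12 x : (0 <= f1 x + f2 x)%R by rewrite addr_ge0.
rewrite intD//; last 2 first.
- exact: measurable_funD.
- by move=> x; rewrite addr_ge0.
by rewrite intD// intD.
Qed.

Lemma smear_ge0 F h nu : (forall x, 0 <= F x)%R -> 0 <= smear F h nu.
Proof.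
move=> F0; apply: integral_ge0 => s _; apply: integral_ge0 => y _.
by rewrite lee_fin mulr_ge0// tent_ge0.
Qed.

(** Integrating [second_difference_exp_convex] over the line and rewriting each
    integral with [integral_potential_smear], the terms in which the functions are
    shifted cancel, and only the mollifications remain. *)
Lemma smear_tangent F G h mu nu : (0 <= h)%R ->
    measurable_fun setT F -> (forall x, 0 <= F x)%R ->
    measurable_fun setT G -> (forall x, 0 <= G x)%R ->
    (forall x, expR (G x - F x) * potential mu x = potential nu x)%R ->
    \int[lam]_x (F x * potential nu x)%:E < +oo ->
    \int[lam]_x (G x * potential nu x)%:E < +oo ->
    \int[lam]_x (potential nu x)%:E < +oo ->
    \int[lam]_x (1 * potential mu x)%:E < +oo ->
  smear F h nu + smear (fun x => expR (G x - F x))%R h mu <=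
  smear G h nu + smear (fun=> 1%R) h mu.
Proof.
move=> h0 mF F0 mG G0 vE.
have mr : measurable_fun setT (fun x => expR (G x - F x))%R.
  by apply: measurableT_comp => //; exact: measurable_funB.
have r0 x : (0 <= expR (G x - F x))%R by exact: expR_ge0.
have c2 := ge2_expRDexpRN h.
set c := (expR h + expR (- h))%R in c2.
have c0 : (0 <= c)%R by lra.
have u0 x : (0 <= potential mu x)%R by exact/ltW/potential_gt0.
have v0 x : (0 <= potential nu x)%R by exact/ltW/potential_gt0.
have mu_ := measurable_potential mu.
have mv_ := measurable_potential nu.
have msum (f : R -> R) : measurable_fun setT f ->
    measurable_fun setT (fun x => f (x + h) + f (x - h))%R.
  by move=> mf; apply: measurable_funD; apply: (measurableT_comp mf);
    exact: measurable_shift.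
have mM (f g : R -> R) : measurable_fun setT f -> measurable_fun setT g ->
  measurable_fun setT (fun x => f x * g x)%R by exact: measurable_funM.
have mD (f g : R -> R) : measurable_fun setT f -> measurable_fun setT g ->
  measurable_fun setT (fun x => f x + g x)%R by exact: measurable_funD.
have mZ (f : R -> R) : measurable_fun setT f ->
  measurable_fun setT (fun x => c * f x)%R by exact: measurable_funM.
pose a1 x := (F x * potential nu x)%R.
pose a2 x := ((G (x + h) + G (x - h)) * potential nu x)%R.
pose a3 x := ((1 + 1) * potential mu x)%R.
pose b1 x := (G x * potential nu x)%R.
pose b2 x := ((F (x + h) + F (x - h)) * potential nu x)%R.
pose b3 x := ((expR (G (x + h) - F (x + h)) + expR (G (x - h) - F (x - h))) *
  potential mu x)%R.
pose b4 x := (1 * potential mu x)%R.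
have ma1 : measurable_fun setT a1 by exact: mM.
have ma2 : measurable_fun setT a2 by apply: mM => //; exact: msum.
have ma3 : measurable_fun setT a3 by exact: mM.
have mb1 : measurable_fun setT b1 by exact: mM.
have mb2 : measurable_fun setT b2 by apply: mM => //; exact: msum.
have mb3 : measurable_fun setT b3 by apply: mM => //; exact: (msum _ mr).
have mb4 : measurable_fun setT b4 by exact: mM.
have a10 x : (0 <= a1 x)%R by rewrite mulr_ge0.
have a20 x : (0 <= a2 x)%R by rewrite mulr_ge0 ?addr_ge0.
have a30 x : (0 <= a3 x)%R by rewrite mulr_ge0 ?addr_ge0.
have b10 x : (0 <= b1 x)%R by rewrite mulr_ge0.
have b20 x : (0 <= b2 x)%R by rewrite mulr_ge0 ?addr_ge0.
have b30 x : (0 <= b3 x)%R by rewrite mulr_ge0 ?addr_ge0.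
have b40 x : (0 <= b4 x)%R by rewrite mulr_ge0.
have integrated : \int[lam]_x (c * a1 x + a2 x + c * potential nu x + a3 x)%:E <=
    \int[lam]_x (c * b1 x + b2 x + b3 x + c * b4 x)%:E.
  apply: ge0_le_integral => //.
  - by move=> x _; rewrite lee_fin !addr_ge0// mulr_ge0.
  - apply/measurable_EFinP; apply: (mD _ _) => //.
    by apply: (mD _ _); [apply: (mD _ _) => //|]; exact: mZ.
  - apply/measurable_EFinP; apply: (mD _ _); last exact: mZ.
    by do 2 apply: (mD _ _) => //; exact: mZ.
  - by move=> x _; rewrite lee_fin; apply: second_difference_exp_convex.
have mc (f : R -> R) : measurable_fun setT f -> (forall x, 0 <= f x)%R ->
    measurable_fun setT (fun x => c * f x)%R /\ (forall x, 0 <= c * f x)%R.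
  by move=> mf f0; split; [exact: mZ|move=> x; rewrite mulr_ge0].
have [[mca1 ca10] [mcv cv0]] := (mc _ ma1 a10, mc _ mv_ v0).
have [[mcb1 cb10] [mcb4 cb40]] := (mc _ mb1 b10, mc _ mb4 b40).
move: integrated; rewrite (intD4 mca1 ca10 ma2 a20 mcv cv0 ma3 a30).
rewrite (intD4 mcb1 cb10 mb2 b20 mb3 b30 mcb4 cb40).
rewrite (intZ c0 ma1 a10) (intZ c0 mv_ v0) (intZ c0 mb1 b10) (intZ c0 mb4 b40).
have gF : c%:E * \int[lam]_x (a1 x)%:E = \int[lam]_x (b2 x)%:E + smear F h nu.
  exact: integral_potential_smear.
have gG : c%:E * \int[lam]_x (b1 x)%:E = \int[lam]_x (a2 x)%:E + smear G h nu.
  exact: integral_potential_smear.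
have gr : c%:E * \int[lam]_x (potential nu x)%:E = \int[lam]_x (b3 x)%:E +
    smear (fun x => expR (G x - F x))%R h mu.
  rewrite -(integral_potential_smear mu h0 mr r0); congr (_ * _).
  by apply: eq_integral => x _; rewrite vE.
have g1 : c%:E * \int[lam]_x (b4 x)%:E = \int[lam]_x (a3 x)%:E +
    smear (fun=> 1%R) h mu.
  by apply: (integral_potential_smear mu h0 (measurable_cst (1%R : R))).
have ige0 (f : R -> R) : (forall x, 0 <= f x)%R -> 0 <= \int[lam]_x (f x)%:E.
  by move=> f0; apply: integral_ge0 => x _; rewrite lee_fin.
have split_fin (X Y Z : \bar R) : c%:E * X = Y + Z -> 0 <= X -> 0 <= Y -> 0 <= Z ->
    X < +oo -> exists b z : R, Y = b%:E /\ Z = z%:E.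
  move=> E X0 Y0 Z0 Xoo; apply: ge0_adde_fin => //; rewrite -E.
  exact: lte_mul_pinfty.
move=> + fF fG fv fu.
have [? [? [e1 e2]]] :=
  split_fin _ _ _ gF (ige0 _ a10) (ige0 _ b20) (smear_ge0 h nu F0) fF.
have [? [? [e3 e4]]] :=
  split_fin _ _ _ gG (ige0 _ b10) (ige0 _ a20) (smear_ge0 h nu G0) fG.
have [? [? [e5 e6]]] :=
  split_fin _ _ _ gr (ige0 _ v0) (ige0 _ b30) (smear_ge0 h mu r0) fv.
have [? [? [e7 e8]]] := split_fin _ _ _ g1 (ige0 _ b40) (ige0 _ a30)
  (smear_ge0 h mu (fun=> ler01)) fu.
rewrite gF gG gr g1 e1 e2 e3 e4 e5 e6 e7 e8 -!EFinD !lee_fin; lra.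
Qed.

End tangent.

(** * The tangent inequality and concavity *)

Section entropy_tangent.
Context {R : realType}.
Local Notation lam := (@lebesgue_measure R).
Implicit Types (nu mu : borel_probability R) (x y s h : R) (F G : R -> R).

Lemma surpriseB nu mu x :
  expR (surprise mu x - surprise nu x) = (potential nu x / potential mu x)%R.
Proof.
rewrite /surprise opprK addrC expRD expRN !lnK// posrE; exact: potential_gt0.
Qed.

(** Adding h to both surprises keeps their difference, hence the ratio of the
    potentials, and makes the first one mollified at scale h at least the original
    surprise; the second one then exceeds the original by at most 2 h, and the
    ratio of the potentials varies by a factor of at most exp(2 h). The mass of
    the tent is a common factor. *)
Lemma entropy_tangent_le_scale h nu mu : (0 < h)%R ->
    finite_first_moment nu -> finite_first_moment mu ->
  \int[nu]_x (surprise nu x)%:E +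
    (expR (- (2 * h)))%:E * \int[mu]_x (potential nu x / potential mu x)%:E <=
  \int[nu]_x (surprise mu x)%:E + (2 * h + 1)%:E.
Proof.
move=> h0; have h0' := ltW h0.
have h20 : (0 <= 2 * h)%R by rewrite mulr_ge0.
pose F x := (surprise nu x + h)%R; pose G x := (surprise mu x + h)%R.
have rE x : (expR (G x - F x) = potential nu x / potential mu x)%R.
  by rewrite -surpriseB; congr expR; rewrite /F /G; ring.
have msurp xi : measurable_fun setT (@surprise R xi) by exact: measurable_surprise.
have mF : measurable_fun setT F by exact: measurable_funD.
have mG : measurable_fun setT G by exact: measurable_funD.
have F0 x : (0 <= F x)%R by rewrite addr_ge0// surprise_ge0.
have G0 x : (0 <= G x)%R by rewrite addr_ge0// surprise_ge0.
have mr : measurable_fun setT (fun x => expR (G x - F x))%R.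
  by apply: measurableT_comp => //; exact: measurable_funB.
have r0 x : (0 <= expR (G x - F x))%R by exact: expR_ge0.
have growth xi x : (surprise xi x + h <= surprise xi 0 + h + `|x|)%R.
  by rewrite addrAC lerD2r (le_trans (surprise_lipschitz xi x 0))// subr0.
have lipD xi s y : (`|y| <= h)%R -> (surprise xi s <= surprise xi (s + y) + h)%R.
  move=> yh; rewrite (le_trans (surprise_lipschitz xi s (s + y)))// lerD2l.
  by rewrite opprD addrA subrr add0r normrN.
have lipU xi s y : (`|y| <= h)%R -> (surprise xi (s + y) <= surprise xi s + h)%R.
  move=> yh; rewrite (le_trans (surprise_lipschitz xi (s + y) s))// lerD2l.
  by rewrite addrAC subrr add0r.
have B1 : tent_mass h * \int[nu]_s (surprise nu s)%:E <= smear F h nu.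
  apply: smear_ge => //; first by move=> x; exact: surprise_ge0.
  by move=> s y; exact: lipD.
have B2 : tent_mass h * \int[mu]_s (expR (- (2 * h)) * expR (G s - F s))%:E <=
    smear (fun x => expR (G x - F x))%R h mu.
  apply: smear_ge => //.
  - exact: measurable_funM.
  - move=> s y yh; rewrite -expRD ler_expR /F /G.
    move: (lipD mu s _ yh) (lipU nu s _ yh).
    move: (surprise mu s) (surprise mu _) (surprise nu s) (surprise nu _) => *; lra.
have B3 : smear G h nu <= tent_mass h * \int[nu]_s (surprise mu s + 2 * h)%:E.
  apply: smear_le => //.
  - exact: measurable_funD.
  - by move=> x; rewrite addr_ge0 ?surprise_ge0.
  - by move=> s y yh; rewrite /G mulr_natl mulr2n addrA lerD2r lipU.
have B4 : smear (fun=> 1%R) h mu <= tent_mass h * \int[mu]_s 1%:E.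
  exact: smear_le.
move=> nu1 mu1.
have fin1 xi : finite_first_moment xi -> \int[lam]_x (1 * potential xi x)%:E < +oo.
  move=> xi1; apply: (integral_linear_growth_fin (F := fun=> 1%R) (a := 1%R)) => //.
  by move=> x; rewrite lerDl.
have key : smear F h nu + smear (fun x => expR (G x - F x))%R h mu <=
    smear G h nu + smear (fun=> 1%R) h mu.
  apply: smear_tangent => //.
  - by move=> x; rewrite rE mulfVK// gt_eqF// potential_gt0.
  - exact: (integral_linear_growth_fin nu1 mF F0 (growth nu)).
  - exact: (integral_linear_growth_fin nu1 mG G0 (growth mu)).
  - have := fin1 _ nu1; under eq_integral do rewrite mul1r; exact.
  - exact: fin1.
have M0 := tent_mass_gt0 h0; have Mfin := tent_mass_fin h0'.
rewrite -(@lee_pmul2l _ (tent_mass h))//.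
have s0 : 0 <= \int[nu]_x (surprise nu x)%:E.
  by apply: integral_ge0 => x _; rewrite lee_fin surprise_ge0.
have s0' : 0 <= \int[nu]_x (surprise mu x)%:E.
  by apply: integral_ge0 => x _; rewrite lee_fin surprise_ge0.
have q0 : 0 <= \int[mu]_x (potential nu x / potential mu x)%:E.
  by apply: integral_ge0 => x _; rewrite -rE lee_fin.
rewrite ge0_muleDr//; last by rewrite mule_ge0// lee_fin expR_ge0.
apply: (@le_trans _ _ (smear F h nu + smear (fun x => expR (G x - F x))%R h mu)).
  apply: leeD => //; apply: le_trans B2.
  rewrite lee_pmul2l// -ge0_integralZl_EFin ?expR_ge0//; last 2 first.
  - by move=> x _; rewrite -rE lee_fin.
  - by apply/measurable_EFinP; apply: eq_measurable_fun mr => x _; rewrite rE.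
  by rewrite le_eqVlt; apply/orP; left; apply/eqP; apply: eq_integral => x _; rewrite rE.
apply: (le_trans key); apply: (le_trans (leeD B3 B4)).
rewrite integral_probability_cst -ge0_muleDr//; last first.
  by apply: integral_ge0 => x _; rewrite lee_fin addr_ge0 ?surprise_ge0.
rewrite lee_pmul2l//; under eq_integral do rewrite EFinD.
rewrite ge0_integralD//; last 2 first.
- by move=> x _; rewrite lee_fin surprise_ge0.
- by apply/measurable_EFinP; exact: msurp.
by rewrite integral_probability_cst -addeA -EFinD.
Qed.

(** The limit of [entropy_tangent_le_scale] as h tends to 0; the scale h = 1
    already shows that the integral of the ratio is finite. *)
Lemma entropy_tangent_le nu mu : finite_first_moment nu -> finite_first_moment mu ->
  entropy (@laplace_kernel R) nu +
    \int[mu]_x (potential nu x / potential mu x)%:E <=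
  1 + \int[nu]_x (surprise mu x)%:E.
Proof.
move=> nu1 mu1; rewrite entropyE.
have scale h (h0 : (0 < h)%R) := entropy_tangent_le_scale h0 nu1 mu1.
have := integral_surprise_fin nu nu1; have := integral_surprise_fin mu nu1.
have : 0 <= \int[nu]_x (surprise nu x)%:E.
  by apply: integral_ge0 => x _; rewrite lee_fin surprise_ge0.
have : 0 <= \int[nu]_x (surprise mu x)%:E.
  by apply: integral_ge0 => x _; rewrite lee_fin surprise_ge0.
have : 0 <= \int[mu]_x (potential nu x / potential mu x)%:E.
  by apply: integral_ge0 => x _; rewrite lee_fin divr_ge0// ltW// potential_gt0.
move: scale; case: (\int[nu]_x (surprise nu x)%:E) => [a||]//.
case: (\int[nu]_x (surprise mu x)%:E) => [b||]//.
case: (\int[mu]_x _) => [c||]//; last first.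
  by move=> /(_ _ ltr01); rewrite gt0_muley ?lte_fin ?expR_gt0.
move=> scale c0 b0 a0 _ _; rewrite !lee_fin in c0 b0 a0.
rewrite -!EFinD lee_fin; apply/ler_addgt0Pr => e e0.
have c1 : (0 < 2 * (1 + c))%R by rewrite mulr_gt0// ltr_pwDl.
(* exp(-2h) >= 1 - 2h leaves an error of 2h (1 + c), which is e for this h *)
have h0 : (0 < e / (2 * (1 + c)))%R by rewrite divr_gt0.
have := scale _ h0; rewrite -EFinM -!EFinD lee_fin.
set h := (e / _)%R; have he : (h * (2 * (1 + c)) = e)%R by rewrite mulfVK// gt_eqF.
have : ((1 - 2 * h) * c <= expR (- (2 * h)) * c)%R.
  by rewrite ler_wpM2r// expR_ge1Dx.
lra.
Qed.

Lemma integral_mixture (t : {i01 R}) nu0 nu1 (f : R -> R) :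
    measurable_fun setT f -> (forall x, 0 <= f x)%R ->
  \int[mixture t nu0 nu1]_x (f x)%:E =
  t%:num%:E * \int[nu0]_x (f x)%:E + (1 - t%:num)%:E * \int[nu1]_x (f x)%:E.
Proof.
move=> mf f0.
have mf' : measurable_fun (setT : set (measurableTypeR R)) (fun x => (f x)%:E).
  exact/measurable_EFinP.
have f0' (x : measurableTypeR R) : setT x -> 0 <= (f x)%:E by rewrite lee_fin.
by rewrite ge0_integral_measure_add// !ge0_integral_mscale.
Qed.

(** The tangent inequalities at mu for nu0 and nu1, averaged: the ratios of the
    potentials average to one because the potential is affine in the measure. *)
Lemma entropy_concave_at (t : R) nu0 nu1 mu : (0 <= t)%R -> (0 <= 1 - t)%R ->
    finite_first_moment nu0 -> finite_first_moment nu1 -> finite_first_moment mu ->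
    (forall f : R -> R, measurable_fun setT f -> (forall x, 0 <= f x)%R ->
      \int[mu]_x (f x)%:E =
      t%:E * \int[nu0]_x (f x)%:E + (1 - t)%:E * \int[nu1]_x (f x)%:E) ->
  t%:E * entropy (@laplace_kernel R) nu0 + (1 - t)%:E * entropy (@laplace_kernel R) nu1 <=
  entropy (@laplace_kernel R) mu.
Proof.
move=> t0 t1 fin0 fin1 finmu muE.
have potE x : potential mu x = (t * potential nu0 x + (1 - t) * potential nu1 x)%R.
  have mlap : measurable_fun setT (laplace_kernel x).
    by apply/measurable_EFinP; exact: measurable_laplace.
  apply: EFin_inj; rewrite EFinD !EFinM (potentialE mu) (potentialE nu0) (potentialE nu1).
  exact: (muE _ mlap (laplace_ge0 x)).
have H0 := entropy_tangent_le fin0 finmu.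
have H1 := entropy_tangent_le fin1 finmu.
pose q (xi : borel_probability R) (x : R) := (potential xi x / potential mu x)%R.
have q0 xi x : (0 <= q xi x)%R by rewrite divr_ge0// ltW// potential_gt0.
have mq xi : measurable_fun setT (q xi).
  have := measurable_surprise xi; have := measurable_surprise mu.
  move=> m1 m2; apply: (eq_measurable_fun (fun x => expR (surprise mu x - surprise xi x)))%R.
    by move=> x _; rewrite surpriseB.
  by apply: measurableT_comp => //; exact: measurable_funB.
have Hq : t%:E * \int[mu]_x (q nu0 x)%:E +
    (1 - t)%:E * \int[mu]_x (q nu1 x)%:E = 1.
  have mqE xi : measurable_fun (setT : set (measurableTypeR R)) (fun x => (q xi x)%:E).
    by apply/measurable_EFinP; exact: mq.
  have qE0 xi (x : measurableTypeR R) : setT x -> 0 <= (q xi x)%:E by rewrite lee_fin.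
  have cq0 (c : R) xi (c0 : (0 <= c)%R) (x : measurableTypeR R) :
      setT x -> 0 <= c%:E * (q xi x)%:E by rewrite mule_ge0 ?lee_fin.
  have mcq (c : R) xi :
      measurable_fun (setT : set (measurableTypeR R)) (fun x => c%:E * (q xi x)%:E).
    exact: emeasurable_funM (measurable_cst _) (mqE _).
  rewrite -(ge0_integralZl_EFin mu measurableT (qE0 nu0) (mqE nu0) t0).
  rewrite -(ge0_integralZl_EFin mu measurableT (qE0 nu1) (mqE nu1) t1).
  rewrite -(ge0_integralD mu measurableT (cq0 _ nu0 t0) (mcq _ _)
    (cq0 _ nu1 t1) (mcq _ _)).
  rewrite -[RHS](integral_probability_cst mu); apply: eq_integral => x _.
  rewrite -!EFinM -EFinD; congr EFin.
  by rewrite /q !mulrA -mulrDl -potE divff// gt_eqF// potential_gt0.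
have Emu := muE _ (measurable_surprise mu) (surprise_ge0 mu).
move: H0 H1 Hq; rewrite !entropyE Emu.
have s0 (xi mu' : borel_probability R) : 0 <= \int[xi]_x (surprise mu' x)%:E.
  by apply: integral_ge0 => x _; rewrite lee_fin surprise_ge0.
have r0 (xi : borel_probability R) : 0 <= \int[mu]_x (q xi x)%:E.
  by apply: integral_ge0 => x _; rewrite lee_fin.
have := integral_surprise_fin nu0 fin0; have := integral_surprise_fin nu1 fin1.
have := integral_surprise_fin mu fin0; have := integral_surprise_fin mu fin1.
move: (s0 nu0 mu) (s0 nu1 mu) (s0 nu0 nu0) (s0 nu1 nu1) (r0 nu0) (r0 nu1).
rewrite /q.
move: (\int[nu0]_x (surprise mu x)%:E) => g0; move: (\int[nu1]_x (surprise mu x)%:E) => g1.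
move: (\int[nu0]_x (surprise nu0 x)%:E) => e0; move: (\int[nu1]_x (surprise nu1 x)%:E) => e1.
move: (\int[mu]_x (potential nu0 x / potential mu x)%:E) => r0'.
move: (\int[mu]_x (potential nu1 x / potential mu x)%:E) => r1.
case: g0 => [g0||]//; case: g1 => [g1||]//; case: e0 => [e0||]//; case: e1 => [e1||]//.
case: r0' => [r0'||]//; case: r1 => [r1||]//.
move=> _ _ _ _ _ _ _ _ _ _.
rewrite -!EFinM -!EFinD !lee_fin => H0 H1 [Hq].
have := ler_wpM2l t0 H0; have := ler_wpM2l t1 H1.
rewrite !mulrDr; lra.
Qed.

End entropy_tangent.

Theorem corollary6p6 (R : realType) :
  concave_on (@finite_first_moment R) (entropy (@laplace_kernel R)) /\
  (forall mu : borel_probability R,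
     finite_first_moment mu -> entropy (@laplace_kernel R) mu < +oo).
Proof.
split; last by move=> mu mu1; rewrite entropyE; exact: integral_surprise_fin.
move=> t nu0 nu1 fin0 fin1; apply: entropy_concave_at => //.
- exact: convex_finite_first_moment.
- by move=> f mf f0; exact: integral_mixture.
Qed.
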